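(* Let $c\neq 0$. There does not exist any proper CR-submanifold $M$ in the complex space form $\hat M_n(c)$ with $\dim_{\mathbb C}\mathcal D\geq 2$ that is recurrent, where $\mathcal D$ is the holomorphic distribution of $M$.
   Context: $\hat M_n(c)$ denotes an $n$-dimensional complex space form: a complete, simply connected Kaehler manifold of complex dimension $n$ with constant holomorphic sectional curvature $4c$; $J$ is its complex structure. CR-submanifolds: let $M$ be an isometrically immersed submanifold of a Kaehler manifold, with normal bundle $TM^\perp$. For $x\in M$ put $\mathcal D_x=T_xM\cap JT_xM$. $M$ is generic if $\dim\mathcal D_x$ is constant along $M$; then $\mathcal D$ is called the holomorphic distribution. A generic submanifold is a CR-submanifold if the orthogonal complement $\mathcal D^\perp$ of $\mathcal D$ in $TM$ satisfies $J\mathcal D^\perp\subset TM^\perp$. It is holomorphic if $\mathcal D^\perp=\{0\}$, totally real if $\mathcal D=\{0\}$, and proper if it is neither holomorphic nor totally real. Recurrent: let $h$ be the second fundamental form of $M$, $\nabla$ the Levi-Civita connection of $M$, $\nabla^\perp$ the normal connection, and $(\bar\nabla_Xh)(Y,Z)=\nabla^\perp_X h(Y,Z)-h(\nabla_XY,Z)-h(Y,\nabla_XZ)$. $M$ is recurrent if there is a 1-form $\tau$ on $M$ such that $(\bar\nabla_Xh)(Y,Z)=\tau(X)h(Y,Z)$ for all $X,Y,Z$ tangent to $M$ (the parallel case $\tau=0$ is included). *)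

(* Defs.v *)
From HB Require Import structures.
From mathcomp Require Import all_boot all_order all_algebra.
From mathcomp Require Import all_classical all_reals all_analysis.

Set Implicit Arguments.
Unset Strict Implicit.
Unset Printing Implicit Defensive.

Import Order.TTheory GRing.Theory Num.Theory.
Import numFieldNormedType.Exports.

Local Open Scope classical_set_scope.
Local Open Scope ring_scope.

(* Tangent vectors in a chart are row vectors, so linear maps and bilinear
   forms act by right multiplication; in particular the differential of [f] at
   [x] is [v |-> v *m jacobian f x]. *)

(* [U] is meant to be open: the functions are total, but only their germs at
   the points of [U] matter. *)
Fixpoint Ck_on (R : realType) (V W : normedModType R) (k : nat)
    (U : set V) (f : V -> W) : Prop :=
  match k with
  | 0 => forall x, U x -> {for x, continuous f}
  | k'.+1 => (forall x, U x -> differentiable f x) /\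
             (forall v, Ck_on k' U (fun x => 'D_v f x))
  end.

Definition smooth_on (R : realType) (V W : normedModType R)
    (U : set V) (f : V -> W) : Prop := forall k, Ck_on k U f.

(* The atlas need not be maximal.  [param i] is the inverse of [coord i] on
   [domain i]; both are total functions with irrelevant values elsewhere. *)
Record manifold (R : realType) (m : nat) := Manifold {
  carrier :> topologicalType;
  hausdorff_carrier : hausdorff_space carrier;
  second_countable_carrier : @second_countable carrier;
  chart : Type;
  domain : chart -> set carrier;
  coord : chart -> carrier -> 'rV[R]_m;
  param : chart -> 'rV[R]_m -> carrier;
  open_domain : forall i, open (domain i);
  cover_domain : forall p, exists i, domain i p;
  open_image : forall i, open (coord i @` domain i);
  coordK : forall i p, domain i p -> param i (coord i p) = p;
  continuous_coord : forall i p, domain i p -> {for p, continuous (coord i)};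
  continuous_param : forall i x, (coord i @` domain i) x ->
    {for x, continuous (param i)};
  smooth_transition : forall i j,
    smooth_on (coord i @` (domain i `&` domain j)) (coord j \o param i) }.

Arguments chart {R m} M : rename.
Arguments domain {R m M} i : rename.
Arguments coord {R m M} i p : rename.
Arguments param {R m M} i x : rename.

Section ManifoldNotions.
Variables (R : realType) (m : nat) (M : manifold R m).

Definition overlap (i j : chart M) : set 'rV[R]_m :=
  coord i @` (domain i `&` domain j).

Definition transition (i j : chart M) : 'rV[R]_m -> 'rV[R]_m :=
  coord j \o param i.

(* A smooth 1-form, as the family of its (column) components in the charts. *)
Record one_form := OneForm {
  form : chart M -> 'rV[R]_m -> 'cV[R]_m;
  smooth_form : forall i, smooth_on (coord i @` domain i) (form i);
  form_compat : forall i j x, overlap i j x ->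
    form i x = jacobian (transition i j) x *m form j (transition i j x) }.

Definition form_eval (t : one_form) (i : chart M) (x v : 'rV[R]_m) : R :=
  (v *m form t i x) 0 0.

End ManifoldNotions.

Section CoordinateRiemannianGeometry.
Variables (R : realType) (m : nat).
Implicit Types (g : 'rV[R]_m -> 'M[R]_m) (x u v w : 'rV[R]_m).
Implicit Types (X Y Z : 'rV[R]_m -> 'rV[R]_m).

Definition inner (G : 'M[R]_m) u v : R := (u *m G *m v^T) 0 0.

(* Koszul formula for constant (hence commuting) fields:
   2 g(nabla_u v, e_k) = u.g(v, e_k) + v.g(u, e_k) - e_k.g(u, v). *)
Definition christoffel g x u v : 'rV[R]_m :=
  let e k : 'rV[R]_m := delta_mx 0 k in
  2^-1 *: ((\row_k ('D_u (fun y => inner (g y) v (e k)) x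
                    + 'D_v (fun y => inner (g y) u (e k)) x
                    - 'D_(e k) (fun y => inner (g y) u v) x))
           *m invmx (g x)).

Definition levi_civita g X Y x : 'rV[R]_m :=
  'D_(X x) Y x + christoffel g x (X x) (Y x).

(* R(u, v)w = nabla_u nabla_v w - nabla_v nabla_u w, the vectors being extended
   to constant fields so that the bracket term vanishes. *)
Definition curvature g x u v w : 'rV[R]_m :=
  levi_civita g (cst u) (levi_civita g (cst v) (cst w)) x
  - levi_civita g (cst v) (levi_civita g (cst u) (cst w)) x.

End CoordinateRiemannianGeometry.

Record riemannian_manifold (R : realType) (m : nat) := RiemannianManifold {
  underlying_manifold :> manifold R m;
  metric : chart underlying_manifold -> 'rV[R]_m -> 'M[R]_m;
  smooth_metric : forall i, smooth_on (coord i @` domain i) (metric i);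
  metric_sym : forall i x, (coord i @` domain i) x ->
    (metric i x)^T = metric i x;
  metric_pos : forall i x, (coord i @` domain i) x ->
    forall v, v != 0 -> 0 < inner (metric i x) v v;
  metric_compat : forall i j x, overlap i j x ->
    let A := jacobian (transition i j) x in
    metric i x = A *m metric j (transition i j x) *m A^T }.

Arguments metric {R m} M i x : rename.

(* Multiplication by the imaginary unit, (x, y) standing for x + i y. *)
Definition Jmx (R : realType) (n : nat) : 'M[R]_(n + n) :=
  block_mx 0 1%:M (- 1%:M) 0.

(* A complex manifold (charts of complex coordinates with holomorphic
   transitions, J being constant in each chart) with a Hermitian metric such
   that nabla J = 0, i.e. nabla_u (J v) = J (nabla_u v). *)
Record kaehler_manifold (R : realType) (n : nat) := KaehlerManifold {
  underlying_riemannian :> riemannian_manifold R (n + n);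
  holomorphic_transition : forall (i j : chart underlying_riemannian) x,
    overlap i j x ->
    Jmx R n *m jacobian (transition i j) x
    = jacobian (transition i j) x *m Jmx R n;
  hermitian_metric : forall (i : chart underlying_riemannian) x,
    (coord i @` domain i) x ->
    forall u v, inner (metric underlying_riemannian i x)
                      (u *m Jmx R n) (v *m Jmx R n)
                = inner (metric underlying_riemannian i x) u v;
  parallel_J : forall (i : chart underlying_riemannian) x,
    (coord i @` domain i) x ->
    forall u v, christoffel (metric underlying_riemannian i) x u (v *m Jmx R n)
                = christoffel (metric underlying_riemannian i) x u v
                  *m Jmx R n }.

Section SpaceForms.
Variable (R : realType).

Definition geodesic (m : nat) (M : riemannian_manifold R m) (gamma : R -> M) :=
  continuous gamma /\
  forall (t : R) (i : chart M), domain i (gamma t) ->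
    let x : R -> 'rV[R]_m := coord i \o gamma in
    [/\ \forall s \near t, derivable x s 1,
        derivable (derive1 x) t 1 &
        derive1 (derive1 x) t
        + christoffel (metric M i) (x t) (derive1 x t) (derive1 x t) = 0].

(* Every geodesic extends to the whole real line. *)
Definition complete_manifold (m : nat) (M : riemannian_manifold R m) :=
  forall (i : chart M) (p : M) (v : 'rV[R]_m), domain i p ->
    exists gamma : R -> M,
      [/\ geodesic gamma, gamma 0 = p & derive1 (coord i \o gamma) 0 = v].

Definition path_connected (T : topologicalType) :=
  forall p q : T, exists gamma : R -> T,
    [/\ {within `[0, 1], continuous gamma}, gamma 0 = p & gamma 1 = q].

Definition null_homotopic_loop (T : topologicalType) (gamma : R -> T) :=
  exists H : R * R -> T,
    [/\ {within `[0, 1]%classic `*` `[0, 1]%classic, continuous H},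
        forall s, s \in `[0, 1] -> H (s, 0) = gamma s,
        forall s, s \in `[0, 1] -> H (s, 1) = gamma 0 &
        forall t, t \in `[0, 1] -> H (0, t) = gamma 0 /\ H (1, t) = gamma 0].

Definition simply_connected (T : topologicalType) :=
  path_connected T /\
  forall gamma : R -> T, {within `[0, 1], continuous gamma} ->
    gamma 0 = gamma 1 -> null_homotopic_loop gamma.

(* The sectional curvature of every plane spanned by u and J u is k. *)
Definition constant_holomorphic_curvature (n : nat) (N : kaehler_manifold R n)
    (k : R) :=
  forall (i : chart N) x, (coord i @` domain i) x ->
  forall u, u != 0 ->
    let g := metric N i in
    let Ju := u *m Jmx R n in
    inner (g x) (curvature g x u Ju Ju) u
    / (inner (g x) u u * inner (g x) Ju Ju - inner (g x) u Ju ^+ 2) = k.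

Definition complex_space_form (n : nat) (N : kaehler_manifold R n) (c : R) :=
  [/\ complete_manifold N, simply_connected N &
      constant_holomorphic_curvature N (4 * c)].

End SpaceForms.

Section LocalMaps.
Variables (R : realType) (m k : nat) (M : manifold R m) (N : manifold R k).
Variable f : M -> N.

Definition local_domain (i : chart M) (j : chart N) : set 'rV[R]_m :=
  coord i @` (domain i `&` f @^-1` domain j).

Definition local_map (i : chart M) (j : chart N) : 'rV[R]_m -> 'rV[R]_k :=
  coord j \o f \o param i.

Definition smooth_map :=
  continuous f /\
  forall i j, smooth_on (local_domain i j) (local_map i j).

End LocalMaps.

Definition isometric_immersion (R : realType) (m k : nat)
    (M : riemannian_manifold R m) (N : riemannian_manifold R k) (f : M -> N) :=
  smooth_map f /\
  forall (i : chart M) (j : chart N) x, local_domain f i j x ->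
    let F := local_map f i j in
    row_free (jacobian F x) /\
    metric M i x = jacobian F x *m metric N j (F x) *m (jacobian F x)^T.

(* Extrinsic geometry of an immersion written in charts as F, with metric g on
   the source and G on the target.  Subspaces of the tangent spaces of the
   target are row spaces of matrices. *)
Section SecondFundamentalForm.
Variables (R : realType) (m k : nat) (F : 'rV[R]_m -> 'rV[R]_k).
Variables (g : 'rV[R]_m -> 'M[R]_m) (G : 'rV[R]_k -> 'M[R]_k).
Implicit Types (x : 'rV[R]_m) (X Y Z : 'rV[R]_m -> 'rV[R]_m).
Implicit Types (xi W : 'rV[R]_m -> 'rV[R]_k).

Definition tangent_space x : 'M[R]_k := <<jacobian F x>>%MS.

Definition orthogonal_space (q : nat) x (A : 'M[R]_(q, k)) : 'M[R]_k :=
  kermx (G (F x) *m A^T).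

Definition normal_space x : 'M[R]_k := orthogonal_space x (tangent_space x).

Definition normal_part x (w : 'rV[R]_k) : 'rV[R]_k :=
  w *m proj_mx (normal_space x) (tangent_space x).

Definition pushforward Y : 'rV[R]_m -> 'rV[R]_k :=
  fun x => Y x *m jacobian F x.

(* The Levi-Civita connection of the target on fields W along F. *)
Definition nabla_along X W x : 'rV[R]_k :=
  'D_(X x) W x + christoffel G (F x) (pushforward X x) (W x).

Definition second_fundamental_form Y Z x : 'rV[R]_k :=
  normal_part x (nabla_along Y (pushforward Z) x).

Definition normal_connection X xi x : 'rV[R]_k :=
  normal_part x (nabla_along X xi x).

Definition nabla_bar_h X Y Z x : 'rV[R]_k :=
  normal_connection X (second_fundamental_form Y Z) x
  - second_fundamental_form (levi_civita g X Y) Z x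
  - second_fundamental_form Y (levi_civita g X Z) x.

End SecondFundamentalForm.

(* All these notions are local and tensorial, so fields on the domain of a pair
   of charts suffice. *)
Definition recurrent (R : realType) (m k : nat)
    (M : riemannian_manifold R m) (N : riemannian_manifold R k) (f : M -> N) :=
  exists tau : one_form M,
  forall (i : chart M) (j : chart N) (X Y Z : 'rV[R]_m -> 'rV[R]_m),
    let U := local_domain f i j in
    let F := local_map f i j in
    smooth_on U X -> smooth_on U Y -> smooth_on U Z ->
    forall x, U x ->
      nabla_bar_h F (metric M i) (metric N j) X Y Z x
      = form_eval tau i x (X x)
        *: second_fundamental_form F (metric N j) Y Z x.

Section CRSubmanifolds.
Variables (R : realType) (m n : nat).
Variables (M : riemannian_manifold R m) (N : kaehler_manifold R n).
Variable f : M -> N.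

(* D = TM :&: J TM and its orthogonal complement in TM, at the point with
   coordinates x, as subspaces of the tangent space of N in the chart j. *)
Definition D_space (i : chart M) (j : chart N) (x : 'rV[R]_m) :
    'M[R]_(n + n) :=
  let T := tangent_space (local_map f i j) x in (T :&: T *m Jmx R n)%MS.

Definition Dperp_space (i : chart M) (j : chart N) (x : 'rV[R]_m) :
    'M[R]_(n + n) :=
  let F := local_map f i j in
  (tangent_space F x :&: orthogonal_space F (metric N j) x (D_space i j x))%MS.

Definition has_cdim_D (d : nat) :=
  forall i j x, local_domain f i j x -> \rank (D_space i j x) = d.*2.

Definition generic_submanifold := exists r : nat,
  forall i j x, local_domain f i j x -> \rank (D_space i j x) = r.

Definition CR_submanifold :=
  generic_submanifold /\
  forall i j x, local_domain f i j x ->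
    (Dperp_space i j x *m Jmx R n
       <= normal_space (local_map f i j) (metric N j) x)%MS.

Definition holomorphic_submanifold :=
  forall i j x, local_domain f i j x -> \rank (Dperp_space i j x) = 0%N.

Definition totally_real_submanifold :=
  forall i j x, local_domain f i j x -> \rank (D_space i j x) = 0%N.

Definition proper_CR_submanifold :=
  [/\ CR_submanifold, ~ holomorphic_submanifold & ~ totally_real_submanifold].

End CRSubmanifolds.

(* Main.v *)
From Pilot Require Import Defs.
From HB Require Import structures.
From mathcomp Require Import all_boot all_order all_algebra.
From mathcomp Require Import all_classical all_reals all_analysis.
From mathcomp Require Import ring lra zify.

Set Implicit Arguments.
Unset Strict Implicit.
Unset Printing Implicit Defensive.

Import Order.TTheory GRing.Theory Num.Theory.
Import numFieldNormedType.Exports.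
Import Pilot.Defs.

Local Open Scope classical_set_scope.
Local Open Scope ring_scope.

(** The obstruction sits at a single point and comes from the Codazzi equation.
    For a recurrent submanifold it reads
      normal part of R(X, Y) Z = tau(X) h(Y, Z) - tau(Y) h(X, Z),
    R being the curvature of the ambient space ([codazzi_equation]).  On the
    holomorphic distribution D, of real dimension at least 4, the two linear
    forms tau and tau o J have a common zero X <> 0 ([common_zero]).  Taking
    Y = J X makes the right-hand side vanish.

    Since M is not holomorphic, some point carries a nonzero Z in the
    orthogonal complement of D in TM, and J Z is normal because M is a
    CR-submanifold.  Hence <R(X, J X) Z, J Z> = 0.  But X is orthogonal to Z
    and to J Z, and in a space of constant holomorphic sectional curvature 4c
    this forces <R(X, J X) Z, J Z> = - 2 c |X|^2 |Z|^2
    ([space_form_bisectional]), which is nonzero.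

    Everything is computed in one pair of charts.  The last identity is pure
    algebra from the symmetries of the curvature tensor of a Kaehler metric
    ([bisectional_curvature]).  These symmetries, and the Codazzi and Gauss
    equations, rest on the symmetry of second derivatives ([schwarz]) applied
    to the metric and to the immersion, and on the Koszul formula. *)

(** * Differentiability of matrix-valued maps *)

Section DiffMatrix.
Context {R : realType} {V : normedModType R}.

Lemma near_eq_differentiable (W : normedModType R) (f g : V -> W) (x : V) :
  (\near x, f x = g x) -> differentiable f x -> differentiable g x.
Proof.
move=> fg df.
have gx : g x = f x by rewrite (nbhs_singleton fg).
have E : g \o shift x = cst (g x) + 'd f x +o_ (0 : V) id.
  apply/eqaddoP => _/posnumP[e].
  have /eqaddoP/(_ _ (gt0 e)) := diff_locally df.
  apply: filter_app.
  have : \forall h \near (0 : V), f (h + x) = g (h + x).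
    by move/nbhs0P: fg; apply: filter_app; near=> h; rewrite addrC.
  apply: filter_app; near=> h => fgh.
  by rewrite !fctE /= fgh gx.
have D : 'd g x = 'd f x :> (V -> W).
  by apply: diff_unique; first exact: diff_continuous.
by apply/diff_locallyP; rewrite D; split => //; exact: diff_continuous.
Unshelve. all: by end_near. Qed.

Lemma differentiable_sumf (W : normedModType R) (I : Type) (r : seq I)
    (P : pred I) (f : I -> V -> W) (x : V) :
  (forall i, differentiable (f i) x) ->
  differentiable (fun y => \sum_(i <- r | P i) f i y) x.
Proof.
move=> df.
rewrite -fct_sumE.
apply: (big_ind (fun h : V -> W => differentiable h x)) => //.
by move=> ? ? ? ?; exact: differentiableD.
Qed.

Lemma differentiable_prodf (I : Type) (r : seq I)
    (P : pred I) (f : I -> V -> R) (x : V) :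
  (forall i, differentiable (f i) x) ->
  differentiable (fun y => \prod_(i <- r | P i) f i y) x.
Proof.
move=> df.
rewrite -fct_prodE.
apply: (big_ind (fun h : V -> R => differentiable h x)) => //.
by move=> ? ? ? ?; exact: differentiableM.
Qed.

Lemma differentiable_mxP p q (f : V -> 'M[R]_(p, q)) (x : V) :
  differentiable f x <-> forall i j, differentiable (fun y => f y i j) x.
Proof.
split=> [df i j|df].
  apply: (@differentiable_comp _ _ _ _ f (fun N : 'M[R]_(p, q) => N i j : R) x) => //.
  exact: differentiable_coord.
have -> : f = fun y => \sum_i \sum_j f y i j *: delta_mx i j.
  by apply/funext => y; exact: matrix_sum_delta.
apply: differentiable_sumf => i; apply: differentiable_sumf => j.
exact: differentiableZl.
Qed.

Lemma differentiable_mulmx p q s (f : V -> 'M[R]_(p, q)) (g : V -> 'M[R]_(q, s))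
    (x : V) :
  differentiable f x -> differentiable g x ->
  differentiable (fun y => f y *m g y) x.
Proof.
move=> /differentiable_mxP df /differentiable_mxP dg.
apply/differentiable_mxP => i j.
under eq_fun do rewrite mxE.
by apply: differentiable_sumf => k; exact: differentiableM.
Qed.

Lemma differentiable_trmx p q (f : V -> 'M[R]_(p, q)) (x : V) :
  differentiable f x -> differentiable (fun y => (f y)^T) x.
Proof.
move=> df; apply/differentiable_mxP => i j; under eq_fun do rewrite mxE.
by move/differentiable_mxP: df; exact.
Qed.

Lemma differentiable_det p (f : V -> 'M[R]_p) (x : V) :
  differentiable f x -> differentiable (fun y => \det (f y)) x.
Proof.
move=> /differentiable_mxP df.
apply: differentiable_sumf => s.
apply: differentiableM; first exact: differentiable_cst.
exact: differentiable_prodf.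
Qed.

(** Cramer's rule: the inverse is a rational function of the entries. *)
Lemma differentiable_invmx p (f : V -> 'M[R]_p) (x : V) :
  (\near x, f x \in unitmx) -> differentiable f x ->
  differentiable (fun y => invmx (f y)) x.
Proof.
move=> fu df.
apply: (@near_eq_differentiable _ (fun y => (\det (f y))^-1 *: \adj (f y))).
  by apply: filter_app fu; near=> y => fy; rewrite /invmx fy.
apply/differentiable_mxP => i j.
under eq_fun do rewrite !mxE.
apply: differentiableM.
  apply: differentiableV; first exact: differentiable_det.
  by have := nbhs_singleton fu; rewrite unitmxE unitfE.
rewrite /cofactor; apply: differentiableM; first exact: differentiable_cst.
apply: differentiable_det; apply/differentiable_mxP => k l.
under eq_fun do rewrite !mxE.
by move/differentiable_mxP: df; exact.
Unshelve. all: by end_near. Qed.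

Lemma derive_mxE p q (f : V -> 'M[R]_(p, q)) (x v : V) i j :
  differentiable f x -> ('D_v f x) i j = 'D_v (fun y => f y i j) x.
Proof. by move=> df; rewrite derive_mx ?mxE//; exact: diff_derivable. Qed.

Lemma derive_mulmx p q s (f : V -> 'M[R]_(p, q)) (g : V -> 'M[R]_(q, s))
    (x v : V) :
  differentiable f x -> differentiable g x ->
  'D_v (fun y => f y *m g y) x = 'D_v f x *m g x + f x *m 'D_v g x.
Proof.
move=> df dg; apply/matrixP => i j.
rewrite derive_mxE ?mxE; last exact: differentiable_mulmx.
move/differentiable_mxP: (df) => df'; move/differentiable_mxP: (dg) => dg'.
under eq_fun do rewrite mxE.
rewrite -fct_sumE derive_sum; last first.
  by move=> k; apply: diff_derivable; exact: differentiableM.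
rewrite ?mxE -big_split /=; apply: eq_bigr => k _.
rewrite deriveM; try exact: diff_derivable.
by rewrite !derive_mxE // addrC; congr (_ + _); rewrite mulrC.
Qed.

Lemma deriveDl (W : normedModType R) (f : V -> W) (x : V) (a : R) (u v : V) :
  differentiable f x -> 'D_(a *: u + v) f x = a *: 'D_u f x + 'D_v f x.
Proof. by move=> df; rewrite !deriveE // linearP. Qed.

Lemma derive_chain (W Z : normedModType R) (f : V -> W) (g : W -> Z) (x v : V) :
  differentiable f x -> differentiable g (f x) ->
  'D_v (fun y => g (f y)) x = 'D_('D_v f x) g (f x).
Proof.
move=> df dg; rewrite (deriveE _ df) (deriveE _ dg).
rewrite deriveE; last exact: (differentiable_comp df dg).
by rewrite (diff_comp df dg).
Qed.

End DiffMatrix.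

(** * Symmetry of second derivatives *)

Section Schwarz.
Context {R : realType} {V : normedModType R}.
Implicit Types (f : V -> R) (x y u v : V).

Lemma mean_value_along f x v (t : R) : 0 < t ->
  (forall s, s \in `[0, t] -> differentiable f (s *: v + x)) ->
  exists2 s, s \in `[0, t] & f (t *: v + x) - f x = t * 'D_v f (s *: v + x).
Proof.
move=> t0 df.
have dl (s : R) : is_derive s 1 (fun s : R => s *: v + x) v.
  have ds : differentiable ( *:%R ^~ v : R -> V) s by [].
  have dsv : is_derive s 1 ( *:%R ^~ v : R -> V) v.
    apply: DeriveDef; first exact/derivable1_diffP.
    by rewrite deriveE // diff_val scale1r.
  by have := is_deriveD dsv (is_derive_cst x s 1); rewrite addr0.
have dh (s : R) : s \in `[0, t] ->
    is_derive s 1 (fun s : R => f (s *: v + x)) ('D_v f (s *: v + x)).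
  move=> st.
  have dls : differentiable (fun s : R => s *: v + x) s.
    by apply/derivable1_diffP; case: (dl s).
  apply: DeriveDef.
    apply/derivable1_diffP.
    exact: (differentiable_comp dls (df s st)).
  by rewrite (derive_chain _ dls (df s st)); have [_ ->] := dl s.
have ht : {within `[0, t], continuous (fun s : R => f (s *: v + x))}.
  apply: derivable_within_continuous => s st.
  by case: (dh s st).
have [s st] := @MVT_segment R (fun s : R => f (s *: v + x))
  (fun s => 'D_v f (s *: v + x)) 0 t (ltW t0)
  (fun s st => dh s (subset_itv_oo_cc st)) ht.
by rewrite scale0r add0r subr0 mulrC => ?; exists s.
Qed.

(** The second difference over a parallelogram is symmetric in its two sides,
    while a mean value in each direction turns it into a mixed derivative at
    some point of the parallelogram: this is what identifies the two mixed
    derivatives in the limit. *)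
Lemma second_difference f fu x u v (t : R) : 0 < t ->
  (forall s s', s \in `[0, t] -> s' \in `[0, t] ->
     let y := s *: u + (s' *: v + x) in
     [/\ differentiable f y, 'D_u f y = fu y & differentiable fu y]) ->
  exists s s', [/\ s \in `[0, t], s' \in `[0, t] &
    f (t *: u + (t *: v + x)) - f (t *: u + x) - (f (t *: v + x) - f x)
    = t ^+ 2 * 'D_v fu (s *: u + (s' *: v + x))].
Proof.
move=> t0 df.
have m0 : 0 \in `[0, t] by rewrite in_itv /= lexx ltW.
have mt : t \in `[0, t] by rewrite in_itv /= lexx ltW.
(* The mean value theorem in the direction [u] is applied to the increment
   of [f] along [v]. *)
pose k y := f (y + t *: v) - f y.
have shv y : differentiable (fun y => y + t *: v) y.
  apply: differentiableD; last exact: differentiable_cst.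
  exact: (@ex_diff _ _ _ _ _ id).
have dk1 s : s \in `[0, t] ->
    differentiable (fun y => f (y + t *: v)) (s *: u + x).
  move=> st; apply: (@differentiable_comp _ _ _ _ (fun y => y + t *: v) f) => //.
  by have [+ _ _] := df s t st mt; rewrite (addrC _ x) addrA.
have dk2 s : s \in `[0, t] -> differentiable f (s *: u + x).
  by move=> st; have [+ _ _] := df s 0 st m0; rewrite scale0r add0r.
have dk s : s \in `[0, t] -> differentiable k (s *: u + x).
  by move=> st; apply: differentiableB; [exact: dk1|exact: dk2].
have [s st] := mean_value_along t0 dk.
have -> : 'D_u k (s *: u + x)
    = fu (t *: v + (s *: u + x)) - fu (s *: u + x).
  have [_ + _] := df s 0 st m0; rewrite scale0r add0r => <-.
  have [_ + _] := df s t st mt; rewrite addrCA => <-; rewrite /k deriveB; last 2 first.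
  - by apply: diff_derivable; exact: dk1.
  - by apply: diff_derivable; exact: dk2.
  congr (_ - _).
  rewrite (@derive_chain _ _ _ _ (fun y => y + t *: v) f) //; last first.
    by have [+ _ _] := df s t st mt; rewrite (addrC _ x) addrA.
  rewrite deriveD; last 2 first.
  - exact: derivable_id.
  - exact: derivable_cst.
  by rewrite derive_id derive_cst addr0 addrC.
have [s' s't E2] : exists2 s', s' \in `[0, t] &
    fu (t *: v + (s *: u + x)) - fu (s *: u + x)
    = t * 'D_v fu (s' *: v + (s *: u + x)).
  apply: mean_value_along => // s' s't.
  by rewrite addrCA; have [] := df s s' st s't.
rewrite E2 /k => E1; exists s, s'; split => //.
by rewrite expr2 -mulrA (addrCA (s *: u)) -E1 -(addrA (t *: u) x) (addrC x).
Qed.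

(** The derivatives enter through functions that agree with them on [U], so
    that for a matrix-valued map they can be taken to be entries of its
    derivatives. *)
Lemma schwarz_real (U : set V) f fu fv fuv fvu x u v : open U -> U x ->
  (forall y, U y -> [/\ differentiable f y, 'D_u f y = fu y & 'D_v f y = fv y]) ->
  (forall y, U y -> differentiable fu y /\ 'D_v fu y = fuv y) ->
  (forall y, U y -> differentiable fv y /\ 'D_u fv y = fvu y) ->
  {for x, continuous fuv} -> {for x, continuous fvu} -> fuv x = fvu x.
Proof.
move=> oU Ux df du dv cuv cvu.
apply/eqP; rewrite -subr_eq0 -normr_le0; apply/ler_addgt0Pr => e e0.
rewrite add0r.
have e2 : 0 < e / 2 by rewrite divr_gt0.
have : \forall y \near x, [/\ U y, `|fuv x - fuv y| < e / 2 & `|fvu x - fvu y| < e / 2].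
  have n1 : \forall y \near x, U y by exact: open_nbhs_nbhs.
  have n2 : \forall y \near x, `|fuv x - fuv y| < e / 2.
    by move/cvgrPdist_lt : cuv; exact.
  have n3 : \forall y \near x, `|fvu x - fvu y| < e / 2.
    by move/cvgrPdist_lt : cvu; exact.
  by near=> y; split; near: y.
move=> /nbhs_ballP[_ /posnumP[d] dU].
(* [N] bounds the size of the parallelogram of side [t], which must fit into
   the ball of radius [d]; the summand 1 only keeps [N] positive. *)
pose N := `|u| + `|v| + 1.
have N0 : 0 < N by rewrite ltr_wpDl // addr_ge0.
pose t := d%:num / (2 * N).
have t0 : 0 < t by rewrite divr_gt0 // mulr_gt0.
have near_x s s' : s \in `[0, t] -> s' \in `[0, t] ->
    ball x d%:num (s *: u + (s' *: v + x)).
  rewrite !in_itv /= => /andP[s0 st] /andP[s'0 s't].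
  rewrite -ball_normE /= addrA opprD addrCA subrr addr0 normrN.
  rewrite (le_lt_trans (ler_normD _ _)) // !normrZ !ger0_norm //.
  have : s * `|u| + s' * `|v| <= t * N.
    rewrite /N mulrDr mulr1 mulrDr; apply: ler_wpDr; first exact: ltW.
    by apply: lerD; apply: ler_wpM2r.
  move/le_lt_trans; apply; rewrite /t invfM mulrA mulfVK ?gt_eqF //.
  by rewrite ltr_pdivrMr // ltr_pMr // ltr1n.
have [s [s' [st s't E1]]] : exists s s', [/\ s \in `[0, t], s' \in `[0, t] &
    f (t *: u + (t *: v + x)) - f (t *: u + x) - (f (t *: v + x) - f x)
    = t ^+ 2 * 'D_v fu (s *: u + (s' *: v + x))].
  apply: second_difference => // s s' st s't y.
  have [Uy _ _] := dU _ (near_x _ _ st s't).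
  by have [] := df y Uy; have [] := du y Uy.
have near_x' r r' : r \in `[0, t] -> r' \in `[0, t] ->
    ball x d%:num (r *: v + (r' *: u + x)).
  by move=> rt r't; rewrite addrCA; exact: near_x.
have [r [r' [rt r't E2]]] : exists s s', [/\ s \in `[0, t], s' \in `[0, t] &
    f (t *: v + (t *: u + x)) - f (t *: v + x) - (f (t *: u + x) - f x)
    = t ^+ 2 * 'D_u fv (s *: v + (s' *: u + x))].
  apply: second_difference => // r r' rt r't y.
  have [Uy _ _] := dU _ (near_x' _ _ rt r't).
  by have [] := df y Uy; have [] := dv y Uy.
have [Up pe _] := dU _ (near_x _ _ st s't).
have [Uq _ qe] := dU _ (near_x' _ _ rt r't).
have E : fuv (s *: u + (s' *: v + x)) = fvu (r *: v + (r' *: u + x)).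
  apply: (@mulfI _ (t ^+ 2)); first by rewrite expf_eq0 gt_eqF.
  have [_ <-] := du _ Up; have [_ <-] := dv _ Uq.
  rewrite -E1 -E2 (addrCA (t *: u)); ring.
have -> : fuv x - fvu x = (fuv x - fuv (s *: u + (s' *: v + x)))
    - (fvu x - fvu (r *: v + (r' *: u + x))) by rewrite E; ring.
rewrite (le_trans (ler_normB _ _)) // (splitr e).
by apply: lerD; exact: ltW.
Unshelve. all: by end_near. Qed.

Lemma schwarz p q (U : set V) (f : V -> 'M[R]_(p, q)) x u v : open U -> U x ->
  Ck_on 2 U f -> 'D_v ('D_u f) x = 'D_u ('D_v f) x.
Proof.
move=> oU Ux [df D2].
have [du Du] := D2 u; have [dv Dv] := D2 v.
have contE (h : V -> 'M[R]_(p, q)) i j : {for x, continuous h} ->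
    {for x, continuous (fun y => h y i j)}.
  move=> ch.
  apply: (@continuous_comp _ _ _ h (fun N : 'M[R]_(p, q) => N i j : R)) => //.
  exact: coord_continuous.
apply/matrixP => i j.
apply: (@schwarz_real U (fun y => f y i j) (fun y => ('D_u f y) i j)
  (fun y => ('D_v f y) i j) (fun y => ('D_v ('D_u f) y) i j)
  (fun y => ('D_u ('D_v f) y) i j) x u v) => //.
- move=> y Uy; rewrite !derive_mxE; try exact: df.
  by split => //; move/differentiable_mxP: (df _ Uy); exact.
- move=> y Uy; rewrite derive_mxE; last exact: du.
  by split => //; move/differentiable_mxP: (du _ Uy); exact.
- move=> y Uy; rewrite derive_mxE; last exact: dv.
  by split => //; move/differentiable_mxP: (dv _ Uy); exact.
- by apply: contE; exact: Du.
- by apply: contE; exact: Dv.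
Qed.

End Schwarz.

(** * Directional derivatives and inner products *)

(** Directional derivatives, inner products and Christoffel maps are sealed:
    comparing two of them must stop at their arguments instead of unfolding
    limits of difference quotients. *)
Definition dder (R : realType) (V W : normedModType R) (v : V) (f : V -> W)
  (x : V) : W := locked (@derive R V W) f x v.

Definition ip (R : realType) (m : nat) (G : 'M[R]_m) (u v : 'rV[R]_m) : R :=
  locked (@inner R m) G u v.

Definition chr (R : realType) (m : nat) (g : 'rV[R]_m -> 'M[R]_m)
  (x u v : 'rV[R]_m) : 'rV[R]_m := locked (@christoffel R m) g x u v.

Lemma dderE (R : realType) (V W : normedModType R) v (f : V -> W) x :
  'D_v f x = dder v f x.
Proof. by rewrite /dder -lock. Qed.

Lemma ipE (R : realType) (m : nat) (G : 'M[R]_m) u v : inner G u v = ip G u v.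
Proof. by rewrite /ip -lock. Qed.

Lemma chrE (R : realType) (m : nat) (g : 'rV[R]_m -> 'M[R]_m) x u v :
  christoffel g x u v = chr g x u v.
Proof. by rewrite /chr -lock. Qed.

Section DirectionalDerivative.
Context {R : realType} {V W : normedModType R}.
Implicit Types (f g : V -> W) (x u v : V).

Lemma dder_near f g x v : (\near x, f x = g x) -> dder v f x = dder v g x.
Proof. by rewrite -!dderE; exact: near_eq_derive. Qed.

Lemma dder_cst (a : W) x v : dder v (fun=> a) x = 0.
Proof. by rewrite -dderE; exact: derive_cst. Qed.

Lemma dderD f g x v : differentiable f x -> differentiable g x ->
  dder v (fun y => f y + g y) x = dder v f x + dder v g x.
Proof.
by move=> df dg; rewrite -!dderE; apply: deriveD; exact: diff_derivable.
Qed.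

Lemma dderB f g x v : differentiable f x -> differentiable g x ->
  dder v (fun y => f y - g y) x = dder v f x - dder v g x.
Proof.
by move=> df dg; rewrite -!dderE; apply: deriveB; exact: diff_derivable.
Qed.

Lemma dderZ f x v (a : R) : differentiable f x ->
  dder v (fun y => a *: f y) x = a *: dder v f x.
Proof.
by move=> df; rewrite -!dderE; apply: deriveZ; exact: diff_derivable.
Qed.

Lemma dder_linear f x (a : R) u v : differentiable f x ->
  dder (a *: u + v) f x = a *: dder u f x + dder v f x.
Proof. by move=> df; rewrite -!dderE; exact: deriveDl. Qed.

Lemma dder_sum f x (I : finType) (c : I -> R) (e : I -> V) : differentiable f x ->
  dder (\sum_i c i *: e i) f x = \sum_i c i *: dder (e i) f x.
Proof.
move=> df; rewrite -dderE deriveE // linear_sum.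
by apply: eq_bigr => i _; rewrite -dderE deriveE // linearZ.
Qed.

Lemma dder_chain (Z : normedModType R) f (h : W -> Z) x v :
  differentiable f x -> differentiable h (f x) ->
  dder v (fun y => h (f y)) x = dder (dder v f x) h (f x).
Proof. by rewrite -!dderE; exact: derive_chain. Qed.

End DirectionalDerivative.

Section DirectionalDerivativeMatrix.
Context {R : realType} {V : normedModType R}.

Lemma dder_mx p q (f : V -> 'M[R]_(p, q)) (x v : V) i j :
  differentiable f x -> dder v f x i j = dder v (fun y => f y i j) x.
Proof. by move=> df; rewrite -!dderE derive_mxE. Qed.

Lemma dder_mulmx p q s (f : V -> 'M[R]_(p, q)) (g : V -> 'M[R]_(q, s))
    (x v : V) :
  differentiable f x -> differentiable g x ->
  dder v (fun y => f y *m g y) x = dder v f x *m g x + f x *m dder v g x.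
Proof. by rewrite -!dderE; exact: derive_mulmx. Qed.

Lemma dder_mulmxl p q s (f : V -> 'M[R]_(p, q)) (B : 'M[R]_(q, s)) (x v : V) :
  differentiable f x -> dder v (fun y => f y *m B) x = dder v f x *m B.
Proof.
move=> df; rewrite (@dder_mulmx _ _ _ f (fun=> B)) //.
by rewrite dder_cst mulmx0 addr0.
Qed.

Lemma dder_trmx p q (f : V -> 'M[R]_(p, q)) (x v : V) :
  differentiable f x -> dder v (fun y => (f y)^T) x = (dder v f x)^T.
Proof.
move=> df; apply/matrixP => i j; rewrite mxE !dder_mx //;
  last exact: differentiable_trmx.
by apply: dder_near; near=> y; rewrite mxE.
Unshelve. all: by end_near. Qed.

Lemma dderC p q (U : set V) (f : V -> 'M[R]_(p, q)) x u v : open U -> U x ->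
  Ck_on 2 U f -> dder v (dder u f) x = dder u (dder v f) x.
Proof.
move=> oU Ux f2; have := schwarz u v oU Ux f2.
have E w : 'D_w f = dder w f by apply/funext => y; rewrite dderE.
by rewrite !E !dderE.
Qed.

End DirectionalDerivativeMatrix.

Section InnerProduct.
Context {R : realType} {m : nat}.
Implicit Types (G : 'M[R]_m) (u v w : 'rV[R]_m).

Lemma ip_mxE G u v : ip G u v = (u *m G *m v^T) 0 0.
Proof. by rewrite -ipE. Qed.

Lemma ipDl G u v w : ip G (u + v) w = ip G u w + ip G v w.
Proof. by rewrite !ip_mxE !mulmxDl mxE. Qed.

Lemma ipDr G u v w : ip G w (u + v) = ip G w u + ip G w v.
Proof. by rewrite !ip_mxE linearD mulmxDr mxE. Qed.

Lemma ipZl G a u w : ip G (a *: u) w = a * ip G u w.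
Proof. by rewrite !ip_mxE -!scalemxAl mxE. Qed.

Lemma ipZr G a u w : ip G w (a *: u) = a * ip G w u.
Proof. by rewrite !ip_mxE linearZ -scalemxAr mxE. Qed.

Lemma ipNl G u w : ip G (- u) w = - ip G u w.
Proof. by rewrite -scaleN1r ipZl mulN1r. Qed.

Lemma ipNr G u w : ip G w (- u) = - ip G w u.
Proof. by rewrite -scaleN1r ipZr mulN1r. Qed.

Lemma ip0l G w : ip G 0 w = 0.
Proof. by rewrite ip_mxE !mul0mx mxE. Qed.

Lemma ip0r G w : ip G w 0 = 0.
Proof. by rewrite ip_mxE trmx0 mulmx0 mxE. Qed.

Lemma ip_linearm (a : R) (G H : 'M[R]_m) u v :
  ip (a *: G + H) u v = a * ip G u v + ip H u v.
Proof. by rewrite !ip_mxE mulmxDr mulmxDl -scalemxAr -scalemxAl !mxE. Qed.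

Lemma ipC G u v : G^T = G -> ip G u v = ip G v u.
Proof.
move=> Gs; rewrite !ip_mxE; have <- : (u *m G *m v^T)^T = v *m G *m u^T.
  by rewrite !trmx_mul trmxK Gs mulmxA.
by rewrite [RHS]mxE.
Qed.

Lemma ip_row G u v : ip G u v = \sum_k (u *m G) 0 k * v 0 k.
Proof.
by rewrite ip_mxE mxE; apply: eq_bigr => k _; rewrite [v^T _ _]mxE.
Qed.

Lemma ip_sumr (I : finType) G u (c : I -> R) (e : I -> 'rV[R]_m) :
  ip G u (\sum_i c i *: e i) = \sum_i c i * ip G u (e i).
Proof.
rewrite ip_mxE linear_sum mulmx_sumr summxE.
by apply: eq_bigr => i _; rewrite linearZ -scalemxAr mxE ip_mxE.
Qed.

Lemma ip_summ (I : finType) (c : I -> R) (G : I -> 'M[R]_m) u v :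
  ip (\sum_i c i *: G i) u v = \sum_i c i * ip (G i) u v.
Proof.
rewrite ip_mxE mulmx_sumr mulmx_suml summxE.
by apply: eq_bigr => i _; rewrite -scalemxAr -scalemxAl mxE ip_mxE.
Qed.

End InnerProduct.

Lemma ip_pullback (R : realType) (m k : nat) (J : 'M[R]_(m, k)) (G : 'M[R]_k)
    (u v : 'rV[R]_m) :
  ip (J *m G *m J^T) u v = ip G (u *m J) (v *m J).
Proof. by rewrite !ip_mxE trmx_mul !mulmxA. Qed.

Section DeriveInner.
Context {R : realType} {V : normedModType R} {m : nat}.
Variables (A : V -> 'M[R]_m) (a b : V -> 'rV[R]_m) (x : V).
Hypotheses (dA : differentiable A x) (da : differentiable a x)
  (db : differentiable b x).

Lemma ip_diff : differentiable (fun y => ip (A y) (a y) (b y)) x.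
Proof.
under eq_fun do rewrite ip_mxE.
have := differentiable_mulmx (differentiable_mulmx da dA) (differentiable_trmx db).
by move/differentiable_mxP; exact.
Qed.

Lemma dder_ip v :
  (dder v (fun y => ip (A y) (a y) (b y)) x : R)
  = ip (dder v A x) (a x) (b x) + ip (A x) (dder v a x) (b x)
    + ip (A x) (a x) (dder v b x).
Proof.
have d1 := differentiable_mulmx da dA.
have d2 := differentiable_trmx db.
under eq_fun do rewrite ip_mxE.
rewrite -dder_mx; last exact: differentiable_mulmx.
rewrite dder_mulmx // dder_mulmx // dder_trmx // !mulmxDl !ip_mxE.
by rewrite [LHS]mxE [X in X + _]mxE [X in X + _ = _]addrC.
Qed.

End DeriveInner.

(** * The Levi-Civita connection and the Riemann tensor in a chart *)

Section Metric.
Context {R : realType} {m : nat}.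
Variables (U : set 'rV[R]_m) (g : 'rV[R]_m -> 'M[R]_m).
Hypotheses (oU : open U) (sg : smooth_on U g)
  (g_sym : forall x, U x -> (g x)^T = g x)
  (g_pos : forall x, U x -> forall v, v != 0 -> 0 < ip (g x) v v).
Implicit Types (x u v w : 'rV[R]_m).

Let n2 : (2 : R) != 0. Proof. by rewrite pnatr_eq0. Qed.

Lemma near_open x : U x -> \forall y \near x, U y.
Proof. by move=> Ux; exact: open_nbhs_nbhs. Qed.

Lemma metric_inj x a b : U x ->
  (forall w, ip (g x) a w = ip (g x) b w) -> a = b.
Proof.
move=> Ux ab; apply/eqP; rewrite -subr_eq0; apply/negPn/negP => /(g_pos Ux).
by rewrite ipDl ipNl ab subrr ltxx.
Qed.

Lemma metric_unit x : U x -> g x \in unitmx.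
Proof.
move=> Ux; rewrite -row_free_unit -kermx_eq0.
apply/eqP/row_matrixP => i; rewrite row0.
apply: (metric_inj Ux) => w; rewrite ip0l ip_mxE -row_mul mulmx_ker.
by rewrite row0 mul0mx mxE.
Qed.

Lemma metric_diff x : U x -> differentiable g x.
Proof. by move=> Ux; have [d _] := sg 1; exact: d. Qed.

Lemma metric_diff2 x u : U x -> differentiable (dder u g) x.
Proof.
have -> : dder u g = 'D_u g by apply/funext => y; rewrite dderE.
by move=> Ux; have [_ /(_ u)[d _]] := sg 2; exact: d.
Qed.

Lemma dder_metric x u v w : U x ->
  dder u (fun y => ip (g y) v w) x = ip (dder u g x) v w.
Proof.
move=> Ux; rewrite (@dder_ip _ _ _ g (fun=> v) (fun=> w)) //; last first.
  exact: metric_diff.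
by rewrite !dder_cst ip0l ip0r !addr0.
Qed.

Lemma dder_metric_sym x u : U x -> (dder u g x)^T = dder u g x.
Proof.
move=> Ux; rewrite -dder_trmx; last exact: metric_diff.
apply: dder_near; have := near_open Ux.
by apply: filterS => y; exact: g_sym.
Qed.

Lemma chr_def x u v : U x ->
  chr g x u v = 2^-1 *: ((\row_k (ip (dder u g x) v (delta_mx 0 k)
    + ip (dder v g x) u (delta_mx 0 k) - ip (dder (delta_mx 0 k) g x) u v))
    *m invmx (g x)).
Proof.
move=> Ux; rewrite -chrE /christoffel; congr (_ *: (_ *m _)).
have E a b c : 'D_a (fun y => inner (g y) b c) x = ip (dder a g x) b c.
  by rewrite -dder_metric // dderE; congr dder; apply/funext => y; rewrite ipE.
by apply/rowP => k; rewrite mxE [RHS]mxE !E.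
Qed.

(** The definition of the Christoffel map is the Koszul formula for the vectors
    of the canonical basis; both sides are linear in [w]. *)
Lemma koszul x u v w : U x ->
  2 * ip (g x) (chr g x u v) w
  = ip (dder u g x) v w + ip (dder v g x) u w - ip (dder w g x) u v.
Proof.
move=> Ux; rewrite ip_row chr_def // -scalemxAl mulmxKV ?metric_unit //.
have Ew : dder w g x = \sum_k w 0 k *: dder (delta_mx 0 k) g x.
  rewrite [X in dder X g x](row_sum_delta w) dder_sum //.
  exact: metric_diff.
have lin G a : ip G a w = \sum_k w 0 k * ip G a (delta_mx 0 k).
  by rewrite [X in ip G a X](row_sum_delta w) ip_sumr.
rewrite Ew ip_summ (lin _ v) (lin _ u) -big_split -sumrB mulr_sumr.
apply: eq_bigr => k _; rewrite mxE [X in 2^-1 * X]mxE.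
by rewrite !mulrA divff // mul1r mulrC mulrBr mulrDr.
Qed.

Lemma chr_diff x u v : U x -> differentiable (fun y => chr g y u v) x.
Proof.
move=> Ux.
apply: near_eq_differentiable.
  have := near_open Ux; apply: filterS => y Uy; apply/esym; exact: chr_def.
apply: differentiableZ.
apply: differentiable_mulmx; last first.
  apply: differentiable_invmx; last exact: metric_diff.
  by have := near_open Ux; apply: filterS => y; exact: metric_unit.
apply/differentiable_mxP => i j; under eq_fun do rewrite mxE.
have d a b c : differentiable (fun y => ip (dder a g y) b c) x.
  by apply: (@ip_diff _ _ _ _ (fun=> b) (fun=> c)) => //; exact: metric_diff2.
by apply: differentiableB => //; exact: differentiableD.
Qed.

Lemma chrC x u v : U x -> chr g x u v = chr g x v u.
Proof.
move=> Ux; apply: (metric_inj Ux) => w; apply: (mulfI n2).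
by rewrite !koszul // (ipC u v (dder_metric_sym w Ux)) [X in X - _]addrC.
Qed.

(** The derivative of the metric is the sum of two Koszul formulas. *)
Lemma metric_compatible x u v w : U x ->
  ip (dder u g x) v w
  = ip (g x) (chr g x u v) w + ip (g x) v (chr g x u w).
Proof.
move=> Ux; apply: (mulfI n2).
rewrite mulrDr (ipC v _ (g_sym Ux)) !koszul //.
rewrite (ipC w v (dder_metric_sym u Ux)).
by ring.
Qed.

Lemma chr_linearr x a u v w : U x ->
  chr g x u (a *: v + w) = a *: chr g x u v + chr g x u w.
Proof.
move=> Ux; apply: (metric_inj Ux) => z; apply: (mulfI n2).
rewrite ipDl ipZl mulrDr mulrCA !koszul // dder_linear; last exact: metric_diff.
by rewrite ip_linearm ipDl ipZl ipDr ipZr; ring.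
Qed.

Lemma chr_linearl x a u v w : U x ->
  chr g x (a *: v + w) u = a *: chr g x v u + chr g x w u.
Proof. by move=> Ux; rewrite chrC // chr_linearr // !(chrC u). Qed.

(** The [k]-th coordinate of the Christoffel map is a bilinear form with this
    matrix; this reduces its chain rule to the product rule for [ip]. *)
Definition chr_mx (k : 'I_m) x : 'M[R]_m :=
  \matrix_(i, j) chr g x (delta_mx 0 i) (delta_mx 0 j) 0 k.

Lemma chr_mxE k x u v : U x -> chr g x u v 0 k = ip (chr_mx k x) u v.
Proof.
move=> Ux.
have sum_r a (b : 'rV[R]_m) :
    chr g x a b = \sum_j b 0 j *: chr g x a (delta_mx 0 j).
  have lin : linear (chr g x a) by move=> c b1 b2; rewrite chr_linearr.
  pose fM := GRing.isLinear.Build _ _ _ _ _ lin.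
  pose f : {linear _ -> _} := HB.pack (chr g x a) fM.
  rewrite {1}(row_sum_delta b) -[LHS]/(f _) linear_sum.
  by apply: eq_bigr => j _; rewrite linearZ.
rewrite ip_row sum_r summxE; apply: eq_bigr => j _.
rewrite [LHS]mxE mulrC; congr (_ * _).
rewrite chrC // sum_r summxE [RHS]mxE; apply: eq_bigr => i _.
by rewrite [LHS]mxE [chr_mx _ _ _ _]mxE (chrC _ (delta_mx 0 i)).
Qed.

Lemma chr_mx_diff k x : U x -> differentiable (chr_mx k) x.
Proof.
move=> Ux; apply/differentiable_mxP => i j; under eq_fun do rewrite mxE.
by have /differentiable_mxP := chr_diff (delta_mx 0 i) (delta_mx 0 j) Ux; exact.
Qed.

Lemma dder_chr_mx k x u v w : U x ->
  ip (dder w (chr_mx k) x) u v = dder w (fun y => chr g y u v) x 0 k.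
Proof.
move=> Ux; rewrite dder_mx; last exact: chr_diff.
transitivity (dder w (fun y => ip (chr_mx k y) u v) x); last first.
  apply: dder_near; have := near_open Ux.
  by apply: filterS => y Uy; rewrite chr_mxE.
rewrite (@dder_ip _ _ _ (chr_mx k) (fun=> u) (fun=> v)) //; last first.
  exact: chr_mx_diff.
by rewrite !dder_cst ip0l ip0r !addr0.
Qed.

Section Along.
Variables (V : normedModType R) (F a b : V -> 'rV[R]_m) (x : V).
Hypotheses (UFx : U (F x)) (dF : differentiable F x)
  (da : differentiable a x) (db : differentiable b x).

Lemma near_along : \forall y \near x, U (F y).
Proof.
by apply: (differentiable_continuous dF); exact: near_open.
Qed.

Let coordE k : \forall y \near x,
  ip (chr_mx k (F y)) (a y) (b y) = chr g (F y) (a y) (b y) 0 k.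
Proof.
by have := near_along; apply: filterS => y Uy; rewrite chr_mxE.
Qed.

Let mx_along k : differentiable (fun y => chr_mx k (F y)) x.
Proof.
apply: (@differentiable_comp _ _ _ _ F (chr_mx k)) => //.
exact: chr_mx_diff.
Qed.

Lemma chr_along_diff : differentiable (fun y => chr g (F y) (a y) (b y)) x.
Proof.
apply/differentiable_mxP => i k; rewrite ord1.
apply: near_eq_differentiable; first exact: coordE.
exact: ip_diff.
Qed.

Lemma dder_chr_along (v : V) :
  dder v (fun y => chr g (F y) (a y) (b y)) x
  = dder (dder v F x) (fun z => chr g z (a x) (b x)) (F x)
    + chr g (F x) (dder v a x) (b x) + chr g (F x) (a x) (dder v b x).
Proof.
apply/rowP => k; rewrite dder_mx; last exact: chr_along_diff.
rewrite -(dder_near _ (coordE k)) dder_ip //.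
rewrite dder_chain //; last exact: chr_mx_diff.
by rewrite dder_chr_mx // -!chr_mxE // !mxE.
Qed.

End Along.

(** R(u, v) w = nabla_u nabla_v w - nabla_v nabla_u w for constant fields. *)
Definition riem x u v w : 'rV[R]_m :=
  (dder u (fun y => chr g y v w) x + chr g x u (chr g x v w))
  - (dder v (fun y => chr g y u w) x + chr g x v (chr g x u w)).

Lemma curvatureE x u v w : curvature g x u v w = riem x u v w.
Proof.
have E a : levi_civita g (cst a) (cst w) = fun y => chr g y a w.
  by apply/funext => y; rewrite /levi_civita dderE dder_cst add0r chrE.
by rewrite /curvature !E /levi_civita !dderE !chrE.
Qed.

Lemma riemC x u v w : riem x v u w = - riem x u v w.
Proof. by rewrite /riem opprB. Qed.

Lemma riem_bianchi x u v w : U x -> riem x u v w + riem x v w u + riem x w u v = 0.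
Proof.
move=> Ux.
have E a b c : dder a (fun y => chr g y b c) x = dder a (fun y => chr g y c b) x.
  apply: dder_near; have := near_open Ux.
  by apply: filterS => y Uy; exact: chrC.
rewrite /riem (E u w v) (E v u w) (E w v u).
rewrite (chrC w v Ux) (chrC u w Ux) (chrC v u Ux).
by apply/rowP => k; rewrite !mxE; ring.
Qed.

(** Differentiating the compatibility of the connection with the metric once
    more expresses the second derivatives of the metric, which are symmetric;
    antisymmetrizing leaves the two curvature terms. *)
Lemma riem_skew x u v w z : U x ->
  ip (g x) (riem x u v w) z + ip (g x) w (riem x u v z) = 0.
Proof.
move=> Ux.
have dG a b : differentiable (fun y => chr g y a b) x by exact: chr_diff.
have dg := metric_diff Ux.
have E a b : ip (dder a (dder b g) x) w z
    = (ip (g x) (dder a (fun y => chr g y b w) x + chr g x a (chr g x b w)) z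
       + ip (g x) w (dder a (fun y => chr g y b z) x + chr g x a (chr g x b z)))
      + (ip (g x) (chr g x b w) (chr g x a z)
         + ip (g x) (chr g x a w) (chr g x b z)).
  transitivity (dder a (fun y => ip (dder b g y) w z) x).
    rewrite (@dder_ip _ _ _ (dder b g) (fun=> w) (fun=> z)) //.
      by rewrite !dder_cst ip0l ip0r !addr0.
    exact: metric_diff2.
  transitivity (dder a (fun y => ip (g y) (chr g y b w) z
                               + ip (g y) w (chr g y b z)) x).
    apply: dder_near; have := near_open Ux.
    by apply: filterS => y Uy; exact: metric_compatible.
  have dw : differentiable (fun y => ip (g y) (chr g y b w) z) x.
    exact: (@ip_diff _ _ _ _ _ (fun=> z)).
  have dz : differentiable (fun y => ip (g y) w (chr g y b z)) x.
    exact: (@ip_diff _ _ _ _ (fun=> w)).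
  rewrite dderD //.
  rewrite (@dder_ip _ _ _ g (fun y => chr g y b w) (fun=> z)) //.
  rewrite (@dder_ip _ _ _ g (fun=> w) (fun y => chr g y b z)) //.
  rewrite !dder_cst ip0l ip0r !metric_compatible // !ipDl !ipDr.
  by ring.
have := E u v; rewrite (dderC v u oU Ux (sg 2)) (E v u) /riem.
rewrite !ipDl !ipDr !ipNl !ipNr !ipDl !ipDr => H.
by lra.
Qed.

Lemma riem_linear1 x a u u' v w : U x ->
  riem x (a *: u + u') v w = a *: riem x u v w + riem x u' v w.
Proof.
move=> Ux; rewrite /riem dder_linear; last exact: chr_diff.
have -> : dder v (fun y => chr g y (a *: u + u') w) x
    = a *: dder v (fun y => chr g y u w) x + dder v (fun y => chr g y u' w) x.
  rewrite -dderZ; last exact: chr_diff.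
  rewrite -dderD; last exact: chr_diff; last first.
    by apply: differentiableZ; exact: chr_diff.
  apply: dder_near; have := near_open Ux.
  by apply: filterS => y Uy; exact: chr_linearl.
rewrite !chr_linearl // chr_linearr //.
by apply/rowP => k; rewrite !mxE; ring.
Qed.

(** The condition on [J] is nabla J = 0, so [J] passes through every covariant
    derivative. *)
Lemma riem_parallel (J : 'M[R]_m) x u v w : U x ->
  (forall y, U y -> forall u v, chr g y u (v *m J) = chr g y u v *m J) ->
  riem x u v (w *m J) = riem x u v w *m J.
Proof.
move=> Ux GJ.
have E a b : dder a (fun y => chr g y b (w *m J)) x
    = dder a (fun y => chr g y b w) x *m J.
  rewrite -dder_mulmxl; last exact: chr_diff.
  apply: dder_near; have := near_open Ux.
  by apply: filterS => y Uy; exact: GJ.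
by rewrite /riem !E !GJ // mulmxBl !mulmxDl.
Qed.

End Metric.

(** * Curvature tensors of Kaehler type *)

Section KaehlerCurvatureTensor.
Context {R : realFieldType} {V : zmodType}.
Variables (T : V -> V -> V -> V -> R) (J : V -> V).
Hypotheses (TD1 : forall u u' v w t, T (u + u') v w t = T u v w t + T u' v w t)
  (TC12 : forall u v w t, T v u w t = - T u v w t)
  (TC34 : forall u v w t, T u v t w = - T u v w t)
  (bianchi : forall u v w t, T u v w t + T v w u t + T w u v t = 0)
  (JD : forall u v, J (u + v) = J u + J v) (JJ : forall u, J (J u) = - u)
  (TJ34 : forall u v w t, T u v (J w) (J t) = T u v w t).
Implicit Types u v w t x z : V.

(** The classical octahedron argument: the four Bianchi identities obtained by
    cycling the arguments combine into the claim. *)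
Lemma curvature_pair_sym u v w t : T u v w t = T w t u v.
Proof.
have H1 := bianchi u v w t; have H2 := bianchi v w t u.
have H3 := bianchi w t u v; have H4 := bianchi t u v w.
have := (TC34 v w u t, TC34 w t u v, TC12 v t w u, TC34 v t u w, TC34 u w v t,
  TC12 u w v t, TC34 t u w v, TC34 u v w t).
case=> -[[[[[[E1 E2] E3] E4] E5] E6] E7] E8.
by lra.
Qed.

Let TD2 u v v' w t : T u (v + v') w t = T u v w t + T u v' w t.
Proof. by rewrite TC12 TD1 opprD -!TC12. Qed.

Let TD3 u v w w' t : T u v (w + w') t = T u v w t + T u v w' t.
Proof. by rewrite curvature_pair_sym TD1 -!(curvature_pair_sym u v). Qed.

Let TD4 u v w t t' : T u v w (t + t') = T u v w t + T u v w t'.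
Proof. by rewrite TC34 TD3 opprD -!TC34. Qed.

Let TN1 u v w t : T (- u) v w t = - T u v w t.
Proof.
have T0 : T 0 v w t = 0 by have := TD1 0 0 v w t; rewrite addr0; lra.
by have := TD1 u (- u) v w t; rewrite subrr T0; lra.
Qed.

Let TN2 u v w t : T u (- v) w t = - T u v w t.
Proof. by rewrite TC12 TN1 -TC12. Qed.

Let TN3 u v w t : T u v (- w) t = - T u v w t.
Proof. by rewrite curvature_pair_sym TN1 -curvature_pair_sym. Qed.

Let TN4 u v w t : T u v w (- t) = - T u v w t.
Proof. by rewrite TC34 TN3 -TC34. Qed.

Let JN u : J (- u) = - J u.
Proof. by rewrite -[in LHS](JJ u) !JJ. Qed.

Let TJ12 u v w t : T (J u) (J v) w t = T u v w t.
Proof. by rewrite curvature_pair_sym TJ34 -curvature_pair_sym. Qed.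

Variables (k : R) (N : V -> R).
Hypothesis holomorphic : forall u, T u (J u) (J u) u = k * N u ^+ 2.

(** Comparing the terms of degree two in [z] in the quartic identity
    [holomorphic] at [x + z] and [x - z]. *)
Let polarization x z : N (x + z) = N x + N z -> N (x - z) = N x + N z ->
  T x (J x) z (J z) + 2 * T x (J z) x (J z) = - k * (N x * N z).
Proof.
move=> Np Nm.
have H1 := holomorphic (x + z); have H2 := holomorphic (x - z).
have H3 := holomorphic x; have H4 := holomorphic z.
rewrite Np JD !(TD1, TD2, TD3, TD4) in H1.
rewrite Nm JD JN !(TD1, TD2, TD3, TD4) !(TN1, TN2, TN3, TN4) in H2.
(* The symmetries reduce the six mixed terms to the two in the statement. *)
have E1 : T x (J x) (J z) z = - T x (J x) z (J z) by rewrite TC34.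
have E2 : T z (J z) (J x) x = - T x (J x) z (J z).
  by rewrite curvature_pair_sym TC12.
have E3 : T x (J z) (J z) x = - T x (J z) x (J z) by rewrite TC34.
have E4 : T x (J z) (J x) z = - T x (J z) x (J z).
  by rewrite -TJ34 JJ TN3.
have E5 : T z (J x) (J z) x = - T x (J z) x (J z).
  by rewrite curvature_pair_sym TC12 TC34 E4 opprK.
have E6 : T z (J x) (J x) z = - T x (J z) x (J z).
  by rewrite -TJ12 JJ TN2 TC12 E4; lra.
rewrite E1 E2 E3 E4 E5 E6 H3 H4 in H1 H2.
by lra.
Qed.

(** The polarized identity at [(x, z)] and at [(x, J z)] gives two relations
    between T(x, Jx, z, Jz), T(x, Jz, x, Jz) and T(x, z, x, z); the Bianchi
    identity, which says that the first is the sum of the other two, is the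
    third.  The conditions on [N], the squared norm in the application, express
    that [x] is orthogonal to [z] and to [J z]. *)
Lemma bisectional_curvature x z :
  N (x + z) = N x + N z -> N (x - z) = N x + N z ->
  N (x + J z) = N x + N z -> N (x - J z) = N x + N z -> N (J z) = N z ->
  2 * T x (J x) z (J z) = - k * (N x * N z).
Proof.
move=> Np Nm NJp NJm NJ.
have H1 := polarization Np Nm.
have H2 := @polarization x (J z); rewrite NJ in H2.
have {}H2 := H2 NJp NJm.
have H3 := bianchi x (J x) z (J z).
have E1 : T (J x) z x (J z) = - T x (J z) x (J z).
  by rewrite -TJ12 JJ TN1.
have E2 : T z x (J x) (J z) = - T x z x z by rewrite TC12 TJ34.
rewrite TJ34 JJ TN2 TN4 opprK in H2.
rewrite E1 E2 in H3.
by lra.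
Qed.

End KaehlerCurvatureTensor.

(** * Gauss and Codazzi equations *)

(** [J] stands for the differential of the immersion [F], and right
    multiplication by [Q] for the orthogonal projection onto the normal space;
    only the listed properties of the two matter. *)
Section Immersion.
Context {R : realType} {m k : nat}.
Variables (U : set 'rV[R]_m) (V : set 'rV[R]_k) (F : 'rV[R]_m -> 'rV[R]_k).
Variables (g : 'rV[R]_m -> 'M[R]_m) (G : 'rV[R]_k -> 'M[R]_k).
Variables (J : 'rV[R]_m -> 'M[R]_(m, k)) (Q : 'rV[R]_m -> 'M[R]_k).
Hypotheses (oU : open U) (sF : smooth_on U F) (FV : forall x, U x -> V (F x))
  (JE : forall x v, U x -> v *m J x = dder v F x).
Hypotheses (sg : smooth_on U g) (g_sym : forall x, U x -> (g x)^T = g x)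
  (g_pos : forall x, U x -> forall v, v != 0 -> 0 < ip (g x) v v).
Hypotheses (oV : open V) (sG : smooth_on V G)
  (G_sym : forall x, V x -> (G x)^T = G x)
  (G_pos : forall x, V x -> forall v, v != 0 -> 0 < ip (G x) v v).
Hypothesis g_pull : forall x, U x -> g x = J x *m G (F x) *m (J x)^T.
Hypotheses (QT : forall x, U x -> J x *m Q x = 0)
  (QN : forall x w, U x -> (forall z, ip (G (F x)) w (z *m J x) = 0) ->
    w *m Q x = w).
Implicit Types (x y u v w z : 'rV[R]_m) (X : 'rV[R]_m -> 'rV[R]_k).

Let F_diff x : U x -> differentiable F x.
Proof. by move=> Ux; have [d _] := sF 1; exact: d. Qed.

Let smoothD u : smooth_on U (dder u F).
Proof.
have <- : 'D_u F = dder u F by apply/funext => y; rewrite dderE.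
by move=> n; have [_] := sF n.+1; exact.
Qed.

Let smoothDD u v : smooth_on U (dder u (dder v F)).
Proof.
have <- : 'D_u (dder v F) = dder u (dder v F) by apply/funext => y; rewrite dderE.
by move=> n; have [_] := smoothD v n.+1; exact.
Qed.

Let nearJ x w : U x -> \forall y \near x, w *m J y = dder w F y.
Proof. by move=> Ux; have := near_open oU Ux; apply: filterS => y; exact: JE. Qed.

Let J_diff x : U x -> differentiable J x.
Proof.
move=> Ux; apply/differentiable_mxP => i l.
apply: (@near_eq_differentiable _ _ _ (fun y => dder (delta_mx 0 i) F y 0 l)).
  have := nearJ (delta_mx 0 i) Ux.
  by apply: filterS => y <-; rewrite -rowE mxE.
have [/(_ x Ux)/differentiable_mxP + _] := smoothD (delta_mx 0 i) 1; exact.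
Qed.

Let p_diff x w : U x -> differentiable (fun y => w *m J y) x.
Proof.
by move=> Ux; apply: (differentiable_mulmx (f := fun=> w)) => //; exact: J_diff.
Qed.

Let dp x v w : U x ->
  dder v (fun y => w *m J y) x = dder v (dder w F) x.
Proof. by move=> Ux; apply: dder_near; exact: nearJ. Qed.

Let dpC x v w : U x ->
  dder v (fun y => w *m J y) x = dder w (fun y => v *m J y) x.
Proof. by move=> Ux; rewrite !dp // (dderC w v oU Ux (sF 2)). Qed.

Let ddp x u v w : U x ->
  dder u (dder v (fun y => w *m J y)) x = dder u (dder v (dder w F)) x.
Proof.
move=> Ux; apply: dder_near; have := near_open oU Ux.
by apply: filterS => y; exact: dp.
Qed.

Let ddpC x u v w : U x ->
  dder u (dder v (fun y => w *m J y)) x = dder v (dder u (fun y => w *m J y)) x.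
Proof. by move=> Ux; rewrite !ddp // (dderC v u oU Ux (smoothD w 2)). Qed.

Let dp_diff x v w : U x -> differentiable (dder v (fun y => w *m J y)) x.
Proof.
move=> Ux; apply: (@near_eq_differentiable _ _ _ (dder v (dder w F))).
  by have := near_open oU Ux; apply: filterS => y Uy; rewrite dp.
by have [/(_ x Ux) + _] := smoothDD v w 1.
Qed.

(** The Levi-Civita connection of the target on fields along [F]. *)
Definition nab u X x := dder u X x + chr G (F x) (u *m J x) (X x).

(** The covariant Hessian of [F], whose normal part is the second fundamental
    form. *)
Definition hess v w : 'rV[R]_m -> 'rV[R]_k := nab v (fun y => w *m J y).

Let hessC x v w : U x -> hess v w x = hess w v x.
Proof.
by move=> Ux; rewrite /hess /nab dpC // (chrC oV sG G_sym G_pos _ _ (FV Ux)).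
Qed.

Let hess_diff x v w : U x -> differentiable (hess v w) x.
Proof.
move=> Ux; apply: differentiableD; first exact: dp_diff.
apply: (chr_along_diff oV sG G_sym G_pos) => //; first exact: FV.
- exact: F_diff.
- exact: p_diff.
- exact: p_diff.
Qed.

Let GF_diff x : U x -> differentiable (fun y => G (F y)) x.
Proof.
move=> Ux; apply: (@differentiable_comp _ _ _ _ F G); first exact: F_diff.
by apply: (metric_diff sG); exact: FV.
Qed.

(** Compatibility of the pulled-back connection with the target metric, read
    on the induced metric. *)
Lemma induced_compatible x u v w : U x ->
  ip (dder u g x) v w
  = ip (G (F x)) (hess u v x) (w *m J x) + ip (G (F x)) (v *m J x) (hess u w x).
Proof.
move=> Ux; rewrite -(dder_metric sg _ _ _ Ux).
transitivity (dder u (fun y => ip (G (F y)) (v *m J y) (w *m J y)) x).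
  apply: dder_near; have := near_open oU Ux.
  by apply: filterS => y Uy; rewrite g_pull // ip_pullback.
rewrite (@dder_ip _ _ _ (fun y => G (F y)) (fun y => v *m J y) (fun y => w *m J y)).
- rewrite dder_chain; last 2 first.
  + exact: F_diff.
  + by apply: (metric_diff sG); exact: FV.
  rewrite (metric_compatible oV sG G_sym G_pos _ _ _ (FV Ux)).
  by rewrite /hess /nab -JE // ipDl ipDr; ring.
- exact: GF_diff.
- exact: p_diff.
- exact: p_diff.
Qed.

(** The tangential part of the Hessian and the Levi-Civita connection of the
    induced metric both satisfy the Koszul formula. *)
Lemma gauss_formula x v w z : U x ->
  ip (G (F x)) (hess v w x - chr g x v w *m J x) (z *m J x) = 0.
Proof.
move=> Ux; have Vx := FV Ux.
have := koszul sg g_pos v w z Ux.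
rewrite !induced_compatible // g_pull // ip_pullback ipDl ipNl.
rewrite (hessC w v Ux) (hessC z v Ux) (hessC z w Ux).
rewrite (ipC (w *m J x) _ (G_sym Vx)) (ipC (v *m J x) _ (G_sym Vx)).
by move=> H; lra.
Qed.

Lemma hess_normal x v w : U x ->
  hess v w x *m Q x = hess v w x - chr g x v w *m J x.
Proof.
move=> Ux; rewrite -[RHS](QN Ux) => [|z]; last exact: gauss_formula.
by rewrite mulmxBl -mulmxA QT // mulmx0 subr0.
Qed.

(** The third derivatives of [F] are symmetric, so only the derivatives of the
    Christoffel map of the target and its iterate survive. *)
Lemma hess_commutator x u v w : U x ->
  nab u (hess v w) x - nab v (hess u w) x
  = riem G (F x) (u *m J x) (v *m J x) (w *m J x).
Proof.
move=> Ux; have Vx := FV Ux.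
have E a b : nab a (hess b w) x
    = dder a (dder b (fun y => w *m J y)) x
      + (dder (a *m J x) (fun q => chr G q (b *m J x) (w *m J x)) (F x)
         + chr G (F x) (dder a (fun y => b *m J y) x) (w *m J x)
         + chr G (F x) (b *m J x) (dder a (fun y => w *m J y) x))
      + (chr G (F x) (a *m J x) (dder b (fun y => w *m J y) x)
         + chr G (F x) (a *m J x) (chr G (F x) (b *m J x) (w *m J x))).
  rewrite {1}/nab; congr (_ + _).
    rewrite dderD; last 2 first.
    - exact: dp_diff.
    - apply: (chr_along_diff oV sG G_sym G_pos) => //.
      + exact: F_diff.
      + exact: p_diff.
      + exact: p_diff.
    rewrite (dder_chr_along oV sG G_sym G_pos) //; first by rewrite -JE.
    - exact: F_diff.
    - exact: p_diff.
    - exact: p_diff.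
  rewrite /hess /nab -[dder b _ x]scale1r.
  by rewrite (chr_linearr sG G_pos) // !scale1r.
rewrite !E (ddpC v u w Ux) (dpC v u Ux) /riem.
by apply/rowP => i; rewrite !mxE; ring.
Qed.

Let tan v w : 'rV[R]_m -> 'rV[R]_k := fun y => chr g y v w *m J y.

Let tan_diff x v w : U x -> differentiable (tan v w) x.
Proof.
move=> Ux; apply: differentiable_mulmx; last exact: J_diff.
exact: (chr_diff oU sg g_pos).
Qed.

Lemma nab_hess_normal x u v w : U x ->
  nab u (fun y => hess v w y *m Q y) x = nab u (hess v w) x - nab u (tan v w) x.
Proof.
move=> Ux; rewrite /nab.
have -> : dder u (fun y => hess v w y *m Q y) x
    = dder u (fun y => hess v w y - tan v w y) x.
  apply: dder_near; have := near_open oU Ux.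
  by apply: filterS => y Uy; rewrite hess_normal.
rewrite dderB; last 2 first.
- exact: hess_diff.
- exact: tan_diff.
have chrB a b c : chr G (F x) a (b - c) = chr G (F x) a b - chr G (F x) a c.
  rewrite addrC -scaleN1r (chr_linearr sG G_pos); last exact: FV.
  by rewrite scaleN1r addrC.
rewrite hess_normal // -/(tan v w x) chrB.
by apply/rowP => i; rewrite !mxE; ring.
Qed.

(** The term in nabla_u v is symmetric in [u] and [v], and the term in nabla_u w
    cancels the derivative of the tangential part of the Hessian, which the
    Gauss formula identifies. *)
Lemma codazzi x u v w : U x ->
  (nab u (fun y => hess v w y *m Q y) x *m Q x - hess (chr g x u v) w x *m Q x
   - nab v (fun y => chr g y u w *m J y) x *m Q x)
  - (nab v (fun y => hess u w y *m Q y) x *m Q x - hess (chr g x v u) w x *m Q x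
   - nab u (fun y => chr g y v w *m J y) x *m Q x)
  = riem G (F x) (u *m J x) (v *m J x) (w *m J x) *m Q x.
Proof.
move=> Ux; rewrite -hess_commutator // !nab_hess_normal // !mulmxBl.
rewrite (chrC oU sg g_sym g_pos v u Ux).
by apply/rowP => i; rewrite !mxE; ring.
Qed.

End Immersion.

(** * Projection onto the normal space *)

Section NormalProjection.
Context {R : realType} {m k : nat}.
Variables (J : 'M[R]_(m, k)) (G : 'M[R]_k).
Hypothesis G_pos : forall v, v != 0 -> 0 < ip G v v.

Lemma orthogonal_submxP q (A : 'M[R]_(q, k)) (a : 'rV[R]_k) :
  (a <= kermx (G *m A^T))%MS <-> forall b : 'rV[R]_k, (b <= A)%MS -> ip G a b = 0.
Proof.
rewrite sub_kermx; split=> [/eqP aA b /submxP[y ->]|aA].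
  by rewrite ip_mxE trmx_mul !mulmxA -(mulmxA a) aA mul0mx mxE.
apply/eqP/rowP => l; rewrite [RHS]mxE -(aA (row l A)) ?row_sub //.
by rewrite ip_mxE tr_row colE !mulmxA -colE [RHS]mxE.
Qed.

Let T := <<J>>%MS.
Let N := kermx (G *m T^T).

Lemma normal_submxP (a : 'rV[R]_k) :
  (a <= N)%MS <-> forall z, ip G a (z *m J) = 0.
Proof.
rewrite orthogonal_submxP; split=> [aT z|aJ b].
  by apply: aT; rewrite genmxE submxMl.
by rewrite genmxE => /submxP[z ->].
Qed.

Lemma normal_tangent_cap : (N :&: T)%MS = 0.
Proof.
apply/eqP/rowV0P => v; rewrite sub_capmx => /andP[/orthogonal_submxP vN /vN v0].
by apply/eqP/negPn/negP => /G_pos; rewrite v0 ltxx.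
Qed.

(** The normal space is the kernel of a map of rank at most the dimension of
    the tangent space, so the two dimensions add up to [k]. *)
Lemma normal_tangent_sum (a : 'rV[R]_k) : (a <= N + T)%MS.
Proof.
apply: submx_full; rewrite /row_full eqn_leq rank_leq_col /=.
have := mxrank_sum_cap N T; rewrite normal_tangent_cap mxrank0 addn0 => ->.
rewrite mxrank_ker addnC -leq_subLR leq_sub2l //.
by rewrite (leq_trans (mxrankM_maxr _ _)) // mxrank_tr.
Qed.

Lemma tangent_proj : J *m proj_mx N T = 0.
Proof.
by apply: proj_mx_0; [exact: normal_tangent_cap|rewrite genmxE].
Qed.

Lemma normal_proj (a : 'rV[R]_k) :
  (forall z, ip G a (z *m J) = 0) -> a *m proj_mx N T = a.
Proof.
by move=> /normal_submxP aN; apply: proj_mx_id; first exact: normal_tangent_cap.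
Qed.

Lemma ip_proj (G_sym : G^T = G) (a b : 'rV[R]_k) :
  (b <= N)%MS -> ip G (a *m proj_mx N T) b = ip G a b.
Proof.
move=> bN.
rewrite -[in RHS](add_proj_mx normal_tangent_cap (normal_tangent_sum a)) ipDl.
rewrite [X in _ = _ + X](ipC _ _ G_sym).
have /orthogonal_submxP -> := bN; first by rewrite addr0.
exact: proj_mx_sub.
Qed.

End NormalProjection.

(** * Immersions read in charts *)

Section Smooth.
Context {R : realType} {V W : normedModType R}.

Lemma smooth_on_subset (A B : set V) (f : V -> W) :
  A `<=` B -> smooth_on B f -> smooth_on A f.
Proof.
move=> AB sf n; have {sf} := sf n.
elim: n f => [|n IH] f /= sf; first by move=> x /AB; exact: sf.
by case: sf => df sf; split=> [x /AB|v]; [exact: df|exact: IH].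
Qed.

Lemma smooth_on_cst (A : set V) (w : W) : smooth_on A (cst w).
Proof.
move=> n; elim: n w => [|n IH] w /=; first by move=> x _; exact: cst_continuous.
split=> [x _|v]; first exact: differentiable_cst.
have -> : (fun x => 'D_v (cst w) x) = cst (0 : W).
  by apply/funext => x; exact: derive_cst.
exact: IH.
Qed.

End Smooth.

Section Charts.
Context {R : realType} {m k : nat}.
Variables (M : riemannian_manifold R m) (N : riemannian_manifold R k) (f : M -> N).
Variables (i : chart M) (j : chart N).
Hypothesis f_iso : isometric_immersion f.

Let U := local_domain f i j.
Let V := coord j @` domain j.
Let F := local_map f i j.
Let J := jacobian F.
Let Q x := proj_mx (normal_space F (metric N j) x) (tangent_space F x).

Lemma local_domain_sub : U `<=` coord i @` domain i.
Proof. by move=> x [p [pi _] <-]; exists p. Qed.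

Lemma open_local_domain : open U.
Proof.
have [[cf _] _] := f_iso.
rewrite openE => _ [p [pi pj] <-]; rewrite /interior.
have xi : (coord i @` domain i) (coord i p) by exists p.
have n1 : \forall x \near coord i p, (coord i @` domain i) x.
  by apply: open_nbhs_nbhs; split; first exact: open_image.
have n2 : \forall x \near coord i p, domain j (f (param i x)).
  have cp := continuous_param xi.
  have c : {for coord i p, continuous (f \o param i)}.
    by apply: continuous_comp => //; exact: cf.
  apply: c => /=; rewrite coordK //.
  by apply: open_nbhs_nbhs; split; first exact: open_domain.
apply: filterS2 n1 n2 => x [q qi <-]; rewrite coordK // => qj.
by exists q.
Qed.

Lemma local_map_target x : U x -> V (F x).
Proof.
move=> [p [pi pj] <-]; exists (f p) => //.
by rewrite /F /local_map /= coordK.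
Qed.

Let F_smooth : smooth_on U F.
Proof. by have [[_ sf] _] := f_iso; exact: sf. Qed.

Let JE x v : U x -> v *m J x = dder v F x.
Proof.
move=> Ux; rewrite -dderE deriveEjacobian //.
by have [dF _] := F_smooth 1; exact: dF.
Qed.

Let g_pos x : U x -> forall v, v != 0 -> 0 < ip (metric M i x) v v.
Proof.
move=> /local_domain_sub Ux v v0; rewrite -ipE; exact: metric_pos.
Qed.

Lemma target_metric_pos y : V y -> forall v, v != 0 -> 0 < ip (metric N j y) v v.
Proof. by move=> Vy v v0; rewrite -ipE; exact: metric_pos. Qed.

Lemma nabla_alongE G0 (Y : 'rV[R]_m -> 'rV[R]_m) W x :
  nabla_along F G0 Y W x = nab F G0 J (Y x) W x.
Proof. by rewrite /nabla_along /nab dderE chrE. Qed.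

Lemma levi_civita_cst g (u v : 'rV[R]_m) :
  levi_civita g (cst u) (cst v) = fun y => chr g y u v.
Proof.
by apply/funext => y; rewrite /levi_civita dderE dder_cst add0r chrE.
Qed.

Let G := metric N j.

Lemma second_fundamental_formE Y Z :
  second_fundamental_form F G Y Z
  = fun y => nab F G J (Y y) (fun y => Z y *m J y) y *m Q y.
Proof.
by apply/funext => y; rewrite /second_fundamental_form nabla_alongE.
Qed.

Lemma normal_connectionE X xi x :
  normal_connection F G X xi x = nab F G J (X x) xi x *m Q x.
Proof. by rewrite /normal_connection nabla_alongE. Qed.

Lemma codazzi_equation u v w x : U x ->
  let h := nabla_bar_h F (metric M i) (metric N j) in
  h (cst u) (cst v) (cst w) x - h (cst v) (cst u) (cst w) x
  = normal_part F (metric N j) x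
      (riem (metric N j) (F x) (u *m J x) (v *m J x) (w *m J x)).
Proof.
move=> Ux h.
have hE a b : h (cst a) (cst b) (cst w) x
    = nab F (metric N j) J a (fun y => hess F (metric N j) J b w y *m Q y) x *m Q x
      - hess F (metric N j) J (chr (metric M i) x a b) w x *m Q x
      - nab F (metric N j) J b (fun y => chr (metric M i) y a w *m J y) x *m Q x.
  rewrite /h /nabla_bar_h normal_connectionE !levi_civita_cst.
  by rewrite !second_fundamental_formE.
rewrite !hE; apply: (@codazzi _ _ _ U V) => //.
- exact: open_local_domain.
- exact: local_map_target.
- exact: (smooth_on_subset local_domain_sub (@smooth_metric _ _ M i)).
- by move=> y /local_domain_sub; exact: metric_sym.
- exact: open_image.
- exact: smooth_metric.
- exact: metric_sym.
- exact: target_metric_pos.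
- by move=> y Uy; have [_ /(_ i j y Uy)[_ ->]] := f_iso.
- move=> y Uy; apply: tangent_proj; apply: target_metric_pos.
  exact: local_map_target.
- move=> y a Uy; apply: normal_proj; apply: target_metric_pos.
  exact: local_map_target.
Qed.

End Charts.

(** * Holomorphic bisectional curvature of a complex space form *)

Section SpaceFormCurvature.
Context {R : realType} {n : nat} (N : kaehler_manifold R n) (c : R).
Hypothesis curv : constant_holomorphic_curvature N (4 * c).
Variables (j : chart N) (y : 'rV[R]_(n + n)).
Let V := coord j @` domain j.
Let G := metric N j.
Hypothesis Vy : V y.
Let J := Jmx R n.
Let ipG := ip (G y).
Let T u v w t := ipG (riem G y u v w) t.

Lemma JmxJ (u : 'rV[R]_(n + n)) : u *m Jmx R n *m Jmx R n = - u.
Proof.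
rewrite -mulmxA /Jmx mulmx_block !mul0mx !mulmx0 !addr0 !add0r mulmx1 mul1mx.
have -> : block_mx (- 1%:M) 0 0 (- 1%:M) = - 1%:M :> 'M[R]_(n + n).
  by rewrite [in RHS]scalar_mx_block opp_block_mx !oppr0.
by rewrite mulmxN mulmx1.
Qed.

Let oV : open V. Proof. exact: open_image. Qed.
Let sG : smooth_on V G. Proof. exact: smooth_metric. Qed.
Let G_sym x : V x -> (G x)^T = G x. Proof. exact: metric_sym. Qed.
Let G_pos x : V x -> forall v, v != 0 -> 0 < ip (G x) v v.
Proof. exact: target_metric_pos. Qed.

Lemma hermitian u v : ip (metric N j y) (u *m Jmx R n) (v *m Jmx R n)
  = ip (metric N j y) u v.
Proof. by rewrite -!ipE; exact: hermitian_metric. Qed.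

Let sym u v : ipG u v = ipG v u.
Proof. exact: (ipC _ _ (G_sym Vy)). Qed.

Let herm u v : ipG (u *m J) (v *m J) = ipG u v. Proof. exact: hermitian. Qed.

Lemma ip_J (u v : 'rV[R]_(n + n)) :
  ip (metric N j y) u (v *m Jmx R n) = - ip (metric N j y) (u *m Jmx R n) v.
Proof. by rewrite -hermitian JmxJ ipNr. Qed.

Let ip_Jself u : ipG u (u *m J) = 0.
Proof.
have H := ip_J u u; rewrite -/G -/ipG -/J (sym (u *m J)) in H.
by lra.
Qed.

Let holo u : T u (u *m J) (u *m J) u = 4 * c * ipG u u ^+ 2.
Proof.
have [->|u0] := eqVneq u 0; first by rewrite /T /ipG !ip0r expr0n mulr0.
have uu : ipG u u != 0 by rewrite gt_eqF //; exact: (G_pos Vy).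
have : inner (G y) (curvature G y u (u *m J) (u *m J)) u
    / (inner (G y) u u * inner (G y) (u *m J) (u *m J)
       - inner (G y) u (u *m J) ^+ 2) = 4 * c := curv Vy u0.
rewrite curvatureE !ipE -/ipG herm ip_Jself.
rewrite expr0n subr0 -/(T _ _ _ _) => <-.
by rewrite -expr2 divfK // expf_eq0.
Qed.

Lemma space_form_bisectional x z :
  ip (metric N j y) x z = 0 -> ip (metric N j y) x (z *m Jmx R n) = 0 ->
  2 * ip (metric N j y) (riem (metric N j) y x (x *m Jmx R n) z) (z *m Jmx R n)
  = - (4 * c) * (ip (metric N j y) x x * ip (metric N j y) z z).
Proof.
rewrite -/G -/ipG -/J => xz xJz.
have normD u : ipG x u = 0 -> ipG (x + u) (x + u) = ipG x x + ipG u u.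
  by move=> xu; rewrite /ipG !ipDl !ipDr -/ipG (sym u x) xu addr0 add0r.
have normB u : ipG x u = 0 -> ipG (x - u) (x - u) = ipG x x + ipG u u.
  move=> xu; rewrite normD; last by rewrite /ipG ipNr -/ipG xu oppr0.
  by rewrite /ipG ipNl ipNr opprK.
apply: (@bisectional_curvature R _ T (mulmx^~ J) _ _ _ _ _ _ _ _ (fun u => ipG u u)).
- move=> u u' v w t; rewrite /T -[u]scale1r (riem_linear1 oV sG G_sym G_pos) //.
  by rewrite !scale1r /ipG ipDl.
- by move=> u v w t; rewrite /T riemC /ipG ipNl.
- move=> u v w t; have H := riem_skew oV sG G_sym G_pos u v t w Vy.
  by rewrite -/ipG (sym t) in H; rewrite /T; lra.
- move=> u v w t; rewrite /T /ipG -!ipDl (riem_bianchi oV sG G_sym G_pos) //.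
  by rewrite ip0l.
- by move=> u v; rewrite mulmxDl.
- by move=> u; exact: JmxJ.
- move=> u v w t; rewrite /T (riem_parallel oV sG G_pos) //.
  by move=> q Vq a b; rewrite -!chrE; exact: parallel_J.
- exact: holo.
- exact: normD xz.
- exact: normB xz.
- by rewrite normD // herm.
- by rewrite normB // herm.
- exact: herm.
Qed.

End SpaceFormCurvature.

(** * Nonexistence *)

(** Restricting to the kernel of one more linear form lowers the rank by at
    most one. *)
Lemma common_zero (K : fieldType) (k : nat) (A : 'M[K]_k) (s t : 'cV[K]_k) :
  (2 < \rank A)%N ->
  exists x : 'rV[K]_k, [/\ x != 0, (x <= A)%MS, x *m s = 0 & x *m t = 0].
Proof.
move=> rA.
have k1 (B : 'M[K]_k) (r : 'cV[K]_k) : (\rank B <= (\rank (B :&: kermx r)%MS).+1)%N.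
  have := mxrank_sum_cap B (kermx r); have := rank_leq_col (B + kermx r)%MS.
  rewrite mxrank_ker; have := rank_leq_col r; have := rank_leq_row r.
  lia.
have : (A :&: kermx s :&: kermx t)%MS != 0.
  rewrite -mxrank_eq0 -lt0n.
  have := k1 A s; have := k1 (A :&: kermx s)%MS t; lia.
move=> /rowV0Pn[x + x0]; rewrite !sub_capmx !sub_kermx.
by move=> /andP[/andP[xA /eqP xs] /eqP xt]; exists x.
Qed.

(** At a point where D has rank greater than 2, a nonzero vector orthogonal to D
    in TM would contradict the Codazzi equation, evaluated on a vector of D on
    which both tau and tau o J vanish. *)
Lemma no_recurrent_CR_point (R : realType) (n m : nat) (c : R)
    (N : kaehler_manifold R n) (M : riemannian_manifold R m) (f : M -> N)
    (i : chart M) (j : chart N) (x : 'rV[R]_m) :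
  c != 0 -> constant_holomorphic_curvature N (4 * c) ->
  isometric_immersion f -> CR_submanifold f -> recurrent f ->
  local_domain f i j x -> (2 < \rank (D_space f i j x))%N ->
  \rank (Dperp_space f i j x) = 0%N.
Proof.
move=> c0 curv iso [_ CR] [tau rec] Ux rD.
apply/eqP; rewrite mxrank_eq0; apply/negPn/negP => /rowV0Pn[z zD z0].
set F := local_map f i j in zD; set J := jacobian F x; set G := metric N j.
have Vy := local_map_target Ux; rewrite -/F in Vy.
have Gp := target_metric_pos Vy; have Gs := metric_sym Vy; rewrite -/G in Gp Gs.
(* The form tau, read on the image of the differential of [f]. *)
pose t := pinvmx J *m form tau i x.
have [a [a0 aD ta tJa]] := common_zero t (Jmx R n *m t) rD.
have [aT aTJ] : (a <= tangent_space F x)%MS /\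
    (a <= tangent_space F x *m Jmx R n)%MS.
  by move: aD; rewrite sub_capmx => /andP[].
have JaT : (a *m Jmx R n <= tangent_space F x)%MS.
  have /submxP[b ->] := aTJ.
  by rewrite mulmxA JmxJ -mulNmx submxMl.
have JaD : (a *m Jmx R n <= D_space f i j x)%MS.
  by rewrite sub_capmx JaT submxMr.
have [zT zorth] : (z <= tangent_space F x)%MS /\
    forall b : 'rV[R]_(n + n), (b <= D_space f i j x)%MS -> ip (G (F x)) z b = 0.
  move: zD; rewrite sub_capmx => /andP[-> zo]; split=> //.
  exact/orthogonal_submxP.
have Jz_normal : (z *m Jmx R n <= normal_space F G x)%MS.
  by apply: submx_trans (CR i j x Ux); exact: submxMr.
have pushK b : (b <= tangent_space F x)%MS -> b *m pinvmx J *m J = b.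
  by rewrite genmxE => bT; rewrite mulmxKpV.
(* Recurrence kills the covariant derivative of the second fundamental form in
   the directions annihilated by tau. *)
have recur b d w : b *m t = 0 ->
    nabla_bar_h F (metric M i) G (cst (b *m pinvmx J)) (cst d) (cst w) x = 0.
  move=> bt; rewrite rec //; try exact: smooth_on_cst.
  by rewrite /form_eval -mulmxA bt mxE scale0r.
have := codazzi_equation iso (a *m pinvmx J) (a *m Jmx R n *m pinvmx J)
  (z *m pinvmx J) Ux.
rewrite -/F -/J -/G /= !recur ?subrr //; last by rewrite -mulmxA.
rewrite !pushK // => cod.
have az : ip (G (F x)) a z = 0 by rewrite (ipC _ _ Gs) zorth.
have aJz : ip (G (F x)) a (z *m Jmx R n) = 0.
  by rewrite ip_J // (ipC _ _ Gs) zorth // oppr0.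
have := space_form_bisectional curv Vy az aJz.
have -> : ip (G (F x)) (riem G (F x) a (a *m Jmx R n) z) (z *m Jmx R n) = 0.
  by rewrite -(ip_proj (J := J) Gp Gs _ Jz_normal) -/(normal_part F G x _) -cod ip0l.
move/eqP; rewrite mulr0 eq_sym !mulf_eq0 oppr_eq0 mulf_eq0 (negbTE c0) pnatr_eq0.
by rewrite !gt_eqF //; exact: Gp.
Qed.

Theorem corollary5p1 (R : realType) (n : nat) (c : R)
    (N : kaehler_manifold R n) :
  c != 0 -> complex_space_form N c ->
  ~ exists (m : nat) (M : riemannian_manifold R m) (f : M -> N) (d : nat),
      [/\ isometric_immersion f,
          proper_CR_submanifold f,
          has_cdim_D f d /\ (2 <= d)%N &
          recurrent f].
Proof.
move=> c0 [_ _ curv] [m [M [f [d [iso [CR notholo _] [rD d2] rec]]]]].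
apply: notholo => i j x Ux.
apply: (no_recurrent_CR_point c0 curv iso CR rec Ux).
by rewrite (rD i j x Ux); lia.
Qed.
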